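(* Let $K\subset\mathbb{R}^n$ be a convex polyhedron of dimension $d<n$ which is not a hyperplane. Then $\mathbb{R}^n\setminus K$ and $\mathbb{R}^n\setminus\operatorname{Int}(K)$ are polynomial images of $\mathbb{R}^n$.
   Context: A convex polyhedron in $\mathbb{R}^n$ is a finite intersection of closed affine half-spaces; its dimension is that of the smallest affine subspace containing it. $\operatorname{Int}(K)$ denotes the interior of $K$ as a topological manifold with boundary, i.e. its interior relative to the affine subspace it spans (so $\operatorname{Int}(K)=K$ if $K$ is a point). A set $S\subset\mathbb{R}^n$ is a polynomial image of $\mathbb{R}^n$ if $S=f(\mathbb{R}^n)$ for some map $f:\mathbb{R}^n\to\mathbb{R}^n$ with polynomial components. *)

(* Defs.v *)
From HB Require Import structures.
From mathcomp Require Import all_boot all_order all_algebra.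
From mathcomp Require Import all_classical all_reals all_analysis.
(* not imported: the notations of mpoly clash with those of mathcomp-analysis *)
From mathcomp.multinomials Require mpoly.

Set Implicit Arguments.
Unset Strict Implicit.
Unset Printing Implicit Defensive.

Import Order.TTheory GRing.Theory Num.Theory.
Import numFieldNormedType.Exports.

Local Open Scope classical_set_scope.
Local Open Scope ring_scope.

Definition dotp (R : realType) (n : nat) (u x : 'rV[R]_n) : R :=
  \sum_(i < n) u 0 i * x 0 i.

Definition closed_half_space (R : realType) (n : nat) (H : set 'rV[R]_n) : Prop :=
  exists (u : 'rV[R]_n) (b : R), u != 0 /\ H = [set x | dotp u x <= b].

Definition hyperplane (R : realType) (n : nat) (H : set 'rV[R]_n) : Prop :=
  exists (u : 'rV[R]_n) (b : R), u != 0 /\ H = [set x | dotp u x = b].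

(* [m = 0] gives the whole space; the empty polyhedron is allowed. *)
Definition convex_polyhedron (R : realType) (n : nat) (K : set 'rV[R]_n) : Prop :=
  exists (m : nat) (H : 'I_m -> set 'rV[R]_n),
    (forall i, closed_half_space (H i)) /\ K = \bigcap_i H i.

Definition flat (R : realType) (n : nat) (p : 'rV[R]_n)
    (V : {vspace 'rV[R]_n}) : set 'rV[R]_n :=
  [set p + v | v in [set v | v \in V]].

(* The empty set counts as an affine subspace, so that every set, empty or
   not, has a smallest affine subspace containing it. *)
Definition affine_subspace (R : realType) (n : nat) (A : set 'rV[R]_n) : Prop :=
  A = set0 \/ exists (p : 'rV[R]_n) (V : {vspace 'rV[R]_n}), A = flat p V.

Definition affine_hull (R : realType) (n : nat) (S : set 'rV[R]_n) :
    set 'rV[R]_n :=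
  smallest (@affine_subspace R n) S.

(* [d] is an integer because the empty set has dimension -1. *)
Definition has_dimension (R : realType) (n : nat) (S : set 'rV[R]_n)
    (d : int) : Prop :=
  (affine_hull S = set0 /\ d = -1) \/
  exists (p : 'rV[R]_n) (V : {vspace 'rV[R]_n}),
    affine_hull S = flat p V /\ d = (\dim V)%:Z.

(* In [subspace A] the points outside [A] are isolated; this is harmless here
   since [S] is contained in its affine hull. *)
Definition relative_interior (R : realType) (n : nat) (S : set 'rV[R]_n) :
    set 'rV[R]_n :=
  interior (S : set (subspace (affine_hull S))).

Definition polynomial_map (R : realType) (n : nat)
    (p : 'I_n -> mpoly.mpoly n R) (x : 'rV[R]_n) : 'rV[R]_n :=
  \row_i mpoly.meval (fun j => x 0 j) (p i).

Definition polynomial_image (R : realType) (n : nat) (S : set 'rV[R]_n) : Prop :=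
  exists p : 'I_n -> mpoly.mpoly n R, S = range (polynomial_map p).

(* Main.v *)
Require Import Defs.
From HB Require Import structures.
From mathcomp Require Import all_boot all_order all_algebra.
From mathcomp Require Import all_classical all_reals all_analysis.
From mathcomp Require Import ring lra.
From mathcomp.multinomials Require Import (canonicals) mpoly.
From mathcomp.real_closed Require polyrcf.

Import Order.TTheory GRing.Theory Num.Theory.
Import numFieldNormedType.Exports.

Local Open Scope classical_set_scope.
Local Open Scope ring_scope.

Set Implicit Arguments.
Unset Strict Implicit.
Unset Printing Implicit Defensive.

(* Let K lie in a hyperplane Y = 0. The complement of K, and likewise that of
   its relative interior, is the union of {Y != 0} with finitely many open or
   closed half-spaces {X < 0} or {X <= 0}. A half-space {X < 0} is added to a
   polynomial image T containing {Y != 0} by a map acting on the coordinates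
   (X, Y) only, (x, y) |-> (g x y, h x y), such that
   - it is the identity on y = 0, so that T keeps its trace on Y = 0;
   - the other component of the curve h = 0 is mapped by g onto x < 0;
   - on every curve h = c with c != 0, g is onto, because the equations to be
     solved reduce to polynomials of odd degree in one variable.
   A similar map of the whole space starts the induction. If X and Y are
   dependent, then adding {X < 0} changes nothing or gives the whole space; in
   the end no half-space contributes only if K is the hyperplane Y = 0. *)

(** * The dot product and dual vectors of two independent forms *)

Section DotProduct.
Variables (R : realType) (n : nat).
Implicit Types (u v x y : 'rV[R]_n) (a : R).

Lemma dotpC u x : dotp u x = dotp x u.
Proof. by apply: eq_bigr => i _; rewrite mulrC. Qed.

Lemma dotpDr u x y : dotp u (x + y) = dotp u x + dotp u y.
Proof. by rewrite -big_split; apply: eq_bigr => i _; rewrite mxE mulrDr. Qed.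

Lemma dotpZr u a x : dotp u (a *: x) = a * dotp u x.
Proof. by rewrite mulr_sumr; apply: eq_bigr => i _; rewrite mxE mulrCA. Qed.

Lemma dotpDl u v x : dotp (u + v) x = dotp u x + dotp v x.
Proof. by rewrite ![dotp _ x]dotpC dotpDr. Qed.

Lemma dotpZl u a x : dotp (a *: u) x = a * dotp u x.
Proof. by rewrite ![dotp _ x]dotpC dotpZr. Qed.

Lemma dotpNl u x : dotp (- u) x = - dotp u x.
Proof. by rewrite -scaleN1r dotpZl mulN1r. Qed.

Lemma dotpBr u x y : dotp u (x - y) = dotp u x - dotp u y.
Proof. by rewrite dotpDr -scaleN1r dotpZr mulN1r. Qed.

Lemma dotp0l x : dotp 0 x = 0.
Proof. by rewrite -(scale0r 0) dotpZl mul0r. Qed.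

Lemma dotpp_gt0 u : u != 0 -> 0 < dotp u u.
Proof.
move=> u0; rewrite lt_def sumr_ge0 ?andbT => [|i _]; last by rewrite -expr2 sqr_ge0.
apply: contra u0 => /eqP d0; apply/eqP/rowP => i.
have := psumr_eq0P (fun i _ => sqr_ge0 (u 0 i)) d0 => /(_ i isT) /eqP.
by rewrite mxE mulf_eq0 orbb => /eqP.
Qed.

(** Gram-Schmidt: [e] is a multiple of the component of [v] orthogonal to [u], and [f] is [u]
    corrected along [e] and rescaled. Moving along [e] or [f] then changes only one of the two
    forms. *)
Lemma dotp_dual_pair u v : u != 0 -> (forall a, v != a *: u) ->
  exists e f, [/\ dotp u e = 0, dotp v e = 1, dotp u f = 1 & dotp v f = 0].
Proof.
move=> u0 vu; have uu := lt0r_neq0 (dotpp_gt0 u0).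
pose w := v - (dotp u v / dotp u u) *: u.
have w0 : w != 0 by rewrite subr_eq0.
have uw : dotp u w = 0 by rewrite dotpBr dotpZr divfK // subrr.
have vw : dotp v w != 0.
  suff -> : dotp v w = dotp w w by rewrite lt0r_neq0 // dotpp_gt0.
  by rewrite {2}/w dotpDl -scaleNr dotpZl uw mulr0 addr0.
pose e := (dotp v w)^-1 *: w.
have ue : dotp u e = 0 by rewrite dotpZr uw mulr0.
have ve : dotp v e = 1 by rewrite dotpZr mulVf.
exists e, ((dotp u u)^-1 *: (u - dotp v u *: e)).
by split; rewrite // dotpZr dotpBr dotpZr ?ue ?ve ?mulr1 ?mulr0 ?subr0 ?subrr ?mulr0 ?mulVf.
Qed.

End DotProduct.

(** * Polynomial functions and composition of polynomial maps *)

Section PolynomialFunctions.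
Variables (R : realType) (n : nat).
Implicit Types (f g : 'rV[R]_n -> R) (S : set 'rV[R]_n).

Definition polynomial_function f :=
  exists p : mpoly.mpoly n R, forall x, f x = mpoly.meval (fun j => x 0 j) p.

Lemma polynomial_function_cst c : polynomial_function (fun=> c).
Proof. by exists (mpoly.mpolyC n c) => x; rewrite mpoly.mevalC. Qed.

Lemma polynomial_function_coord i : polynomial_function (fun x => x 0 i).
Proof. by exists (mpoly.mpolyX _ (mpoly.mnm1 i)) => x; rewrite mpoly.mevalXU. Qed.

Lemma polynomial_functionD f g : polynomial_function f -> polynomial_function g ->
  polynomial_function (fun x => f x + g x).
Proof. by move=> [p pE] [q qE]; exists (p + q) => x; rewrite mpoly.mevalD pE qE. Qed.

Lemma polynomial_functionM f g : polynomial_function f -> polynomial_function g ->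
  polynomial_function (fun x => f x * g x).
Proof. by move=> [p pE] [q qE]; exists (p * q) => x; rewrite mpoly.mevalM pE qE. Qed.

Lemma polynomial_functionN f : polynomial_function f ->
  polynomial_function (fun x => - f x).
Proof. by move=> [p pE]; exists (- p) => x; rewrite mpoly.mevalN pE. Qed.

Lemma polynomial_functionX f k : polynomial_function f ->
  polynomial_function (fun x => f x ^+ k).
Proof.
move=> fP; elim: k => [|k IH]; first exact: polynomial_function_cst.
under eq_fun do rewrite exprS.
exact: polynomial_functionM.
Qed.

Lemma polynomial_function_dotp u : polynomial_function (dotp u).
Proof.
have -> : dotp u = fun x => \sum_(i <- index_enum 'I_n) u 0 i * x 0 i by [].
elim: (index_enum _) => [|i s IH].
  by under eq_fun do rewrite big_nil; exact: polynomial_function_cst.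
under eq_fun do rewrite big_cons.
apply: polynomial_functionD => //; apply: polynomial_functionM.
  exact: polynomial_function_cst.
exact: polynomial_function_coord.
Qed.

Lemma polynomial_imageT : polynomial_image [set: 'rV[R]_n].
Proof.
exists (fun i => mpoly.mpolyX _ (mpoly.mnm1 i)).
apply/seteqP; split=> // x _; exists x => //.
by apply/rowP => i; rewrite mxE mpoly.mevalXU.
Qed.

Lemma polynomial_image_comp S (F : 'rV[R]_n -> 'rV[R]_n) :
  (forall i, polynomial_function (fun x => F x 0 i)) ->
  polynomial_image S -> polynomial_image (F @` S).
Proof.
move=> /choice[q qE] [p ->].
exists (fun i => mpoly.comp_mpoly [tuple p j | j < n] (q i)).
have FE x : F (polynomial_map p x) =
    polynomial_map (fun i => mpoly.comp_mpoly [tuple p j | j < n] (q i)) x.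
  apply/rowP => i; rewrite [RHS]mxE mpoly.comp_mpoly_meval qE.
  by apply: mpoly.meval_eq => j; rewrite tnth_mktuple mxE.
apply/seteqP; split=> y.
  by move=> [_ [x _ <-] <-]; exists x.
by move=> [x _ <-]; exists (polynomial_map p x); [exists x|].
Qed.

End PolynomialFunctions.

(** * Polynomial maps acting on two affine coordinates *)

Section PlaneMaps.
Variables (R : realType) (n : nat) (u v e f : 'rV[R]_n) (b a : R).
Hypotheses (ue : dotp u e = 0) (ve : dotp v e = 1).
Hypotheses (uf : dotp u f = 1) (vf : dotp v f = 0).
Variables (g h : R -> R -> R).
Hypothesis gP : forall X Y : 'rV[R]_n -> R, polynomial_function X ->
  polynomial_function Y -> polynomial_function (fun p => g (X p) (Y p)).
Hypothesis hP : forall X Y : 'rV[R]_n -> R, polynomial_function X ->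
  polynomial_function Y -> polynomial_function (fun p => h (X p) (Y p)).

Let X p := dotp v p + a.
Let Y p := dotp u p + b.

(* In the affine coordinates [X], [Y] and any others, this map is
   [(g X Y, h X Y)] on the first two and the identity on the others. *)
Definition plane_map p :=
  p + ((g (X p) (Y p) - X p) *: e + (h (X p) (Y p) - Y p) *: f).

Let X_affine p s t : X (p + (s *: e + t *: f)) = X p + s.
Proof. by rewrite /X !dotpDr !dotpZr ve vf; ring. Qed.

Let Y_affine p s t : Y (p + (s *: e + t *: f)) = Y p + t.
Proof. by rewrite /Y !dotpDr !dotpZr ue uf; ring. Qed.

Lemma polynomial_image_plane_map S :
  polynomial_image S -> polynomial_image (plane_map @` S).
Proof.
apply: polynomial_image_comp => i; under eq_fun do rewrite !mxE.
have affP w c : polynomial_function (fun p : 'rV[R]_n => dotp w p + c).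
  apply: polynomial_functionD; first exact: polynomial_function_dotp.
  exact: polynomial_function_cst.
have [XP YP] : polynomial_function X /\ polynomial_function Y by split; exact: affP.
apply: polynomial_functionD; first exact: polynomial_function_coord.
apply: polynomial_functionD; apply: polynomial_functionM;
  rewrite /=; try exact: polynomial_function_cst;
  apply: polynomial_functionD; try exact: polynomial_functionN.
- exact: gP.
- exact: hP.
Qed.

Let plane_map_onto q x y : g x y = X q -> h x y = Y q ->
  exists p, [/\ X p = x, Y p = y & plane_map p = q].
Proof.
move=> gE hE; pose p := q + ((x - X q) *: e + (y - Y q) *: f).
have pX : X p = x by rewrite X_affine subrKC.
have pY : Y p = y by rewrite Y_affine subrKC.
exists p; split=> //.
rewrite /plane_map pX pY gE hE; apply/rowP => i; rewrite !mxE; ring.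
Qed.

Let X_plane p : X (plane_map p) = g (X p) (Y p).
Proof. by rewrite X_affine subrKC. Qed.

Let Y_plane p : Y (plane_map p) = h (X p) (Y p).
Proof. by rewrite Y_affine subrKC. Qed.

Variable A : set R.

(** All other coordinates being fixed, [q] is in the range as soon as [(X q, Y q)] is a value of
    [(g, h)]. The three hypotheses describe these values off and on the line [h = 0]. *)
Lemma range_plane_map :
  (forall s c, c != 0 -> exists x y, g x y = s /\ h x y = c) ->
  (forall x y, h x y = 0 -> A (g x y)) ->
  (forall s, A s -> exists x y, g x y = s /\ h x y = 0) ->
  polynomial_image ([set p | dotp u p + b != 0] `|` [set p | A (dotp v p + a)]).
Proof.
move=> offP onP coverP.
suff -> : [set p | Y p != 0] `|` [set p | A (X p)] = plane_map @` setT.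
  exact/polynomial_image_plane_map/polynomial_imageT.
apply/seteqP; split=> [q|_ [p _ <-]] /=; last first.
  rewrite X_plane Y_plane; have [h0|h0] := eqVneq (h (X p) (Y p)) 0; last by left.
  by right; exact: onP.
have [Y0 [//|Aq]|Y0 _] := eqVneq (Y q) 0.
  have [x [y [gE hE]]] := coverP _ Aq; rewrite -Y0 in hE.
  by have [p [_ _ <-]] := plane_map_onto gE hE; exists p.
have [x [y [gE hE]]] := offP (X q) (Y q) Y0.
by have [p [_ _ <-]] := plane_map_onto gE hE; exists p.
Qed.

(** Points of [T] with [Y = 0] are fixed. All other preimages are required to have [y != 0], since
    only [Y != 0] guarantees that a point lies in [T]. *)
Lemma image_plane_map (T : set 'rV[R]_n) :
  (forall x, g x 0 = x /\ h x 0 = 0) ->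
  (forall s c, c != 0 -> exists x y, [/\ y != 0, g x y = s & h x y = c]) ->
  (forall x y, y != 0 -> h x y = 0 -> A (g x y)) ->
  (forall s, A s -> exists x y, [/\ y != 0, g x y = s & h x y = 0]) ->
  [set p | dotp u p + b != 0] `<=` T -> polynomial_image T ->
  polynomial_image (T `|` [set p | A (dotp v p + a)]).
Proof.
move=> idP offP onP coverP YT /polynomial_image_plane_map.
suff -> : plane_map @` T = T `|` [set p | A (X p)] by [].
have id_on p : Y p = 0 -> plane_map p = p.
  by move=> Y0; rewrite /plane_map Y0 !(idP _).1 !(idP _).2 !subrr !scale0r !addr0.
apply/seteqP; split=> [_ [p Tp <-]|q] /=.
  have [Y0|Y0] := eqVneq (Y p) 0; first by rewrite id_on //; left.
  have [h0|h0] := eqVneq (h (X p) (Y p)) 0.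
    by right; rewrite X_plane; exact: onP.
  by left; apply: YT; rewrite /= -/(Y _) Y_plane.
have lift x y : y != 0 -> g x y = X q -> h x y = Y q -> (plane_map @` T) q.
  move=> y0 gE hE; have [p [_ Yp <-]] := plane_map_onto gE hE.
  by exists p => //; apply: YT; rewrite /= -/(Y p) Yp.
have [Y0|Y0] := eqVneq (Y q) 0.
  case=> [Tq|Aq]; first by exists q => //; exact: id_on.
  have [x [y [y0 gE hE]]] := coverP _ Aq.
  by apply: (lift x y) => //; rewrite Y0.
have [x [y [y0 gE hE]]] := offP (X q) (Y q) Y0.
by move=> _; exact: (lift x y).
Qed.

End PlaneMaps.

(** * Equations of odd degree and the maps that add one half-space *)

Lemma horner_rec_root (R : realType) (c : R) (s : seq R) :
  last c s != 0 -> odd (size s) -> exists x, horner_rec (c :: s) x = 0.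
Proof.
move=> cs0 odd_s; have [|x /rootP] := @polyrcf.odd_poly_root R (Poly (c :: s)).
  (* Coefficients are listed by increasing degree, so the degree is [size s]. *)
  by rewrite (@PolyK R 0 (c :: s)) //= odd_s.
by rewrite horner_Poly; exists x.
Qed.

Section AddHalfSpace.
Variables (R : realType) (n : nat) (u v : 'rV[R]_n) (b a : R).
Hypotheses (u0 : u != 0) (vu : forall c, v != c *: u).

Ltac polynomial_function_tac :=
  repeat first [ assumption | exact: polynomial_function_cst
    | apply: polynomial_functionD | apply: polynomial_functionN
    | apply: polynomial_functionM | apply: polynomial_functionX ].

Lemma polynomial_image_half_space (closed : bool) :
  polynomial_image ([set p | dotp u p + b != 0] `|`
                    [set p | dotp v p + a < 0 ?<= if closed]).
Proof.
have [e [f [ue ve uf vf]]] := dotp_dual_pair u0 vu.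
case: closed.
  (* On [y = 0] the first component is [- x ^+ 2]; on [y = c] with [c != 0] it is a cubic in [x]. *)
  apply: (@range_plane_map R n u v e f b a ue ve uf vf
    (fun x y => y * x ^+ 3 - x ^+ 2)
    (fun _ y => y) _ _ [set s | s <= 0]) => //.
  - by move=> X Y XP YP; polynomial_function_tac.
  - move=> s c c0.
    have [||x /= xE] := @horner_rec_root R (- s) [:: 0; -1; c] => //.
    by exists x, c; split=> //; apply/eqP; rewrite -subr_eq0 -xE; apply/eqP; ring.
  - by move=> x y -> /=; rewrite mul0r sub0r oppr_le0 sqr_ge0.
  - move=> s /= s0; exists (Num.sqrt (- s)), 0.
    by rewrite mul0r sub0r sqr_sqrtr ?opprK ?oppr_ge0.
(* On the hyperbola [x * y = 1] the first component is [- x ^+ 2] with [x != 0], which takes exactly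
   the negative values. *)
apply: (@range_plane_map R n u v e f b a ue ve uf vf
    (fun x y => (x * y - 1) * y - x ^+ 2)
    (fun x y => x * y - 1) _ _ [set s | s < 0]) => //.
- by move=> X Y XP YP; polynomial_function_tac.
- by move=> X Y XP YP; polynomial_function_tac.
(* For [c = -1] the curve [h = c] contains the line [x = 0], on which [g] is [- y]. *)
- move=> s c c0; have [->|c1] := eqVneq c (-1).
    by exists 0, (- s); split; ring.
  (* On [x * y = 1 + c] the equation [g x y = s] becomes
     [x ^ 3 + s * x = c * (1 + c)]. *)
  have k0 : c * (1 + c) != 0 by rewrite mulf_neq0 // addrC -[1]opprK subr_eq0.
  have [||x /= xE] := @horner_rec_root R (- (c * (1 + c))) [:: s; 0; 1].
  + by rewrite /= oner_neq0.
  + by [].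
  have x0 : x != 0.
    by apply: contra k0 => /eqP x0; rewrite x0 in xE; rewrite -oppr_eq0 -xE; apply/eqP; ring.
  exists x, ((1 + c) / x); split; last by field.
  apply/eqP; rewrite -subr_eq0.
  rewrite (_ : _ - s = - ((((0 * x + 1) * x + 0) * x + s) * x - c * (1 + c)) / x).
    by rewrite xE oppr0 mul0r.
  by field.
- move=> x y xy /=; have x0 : x != 0.
    by apply/eqP => x0; move: xy => /eqP; rewrite x0 mul0r sub0r oppr_eq0 oner_eq0.
  by rewrite xy mul0r sub0r oppr_lt0 exprn_even_gt0.
- move=> s /= s0; have r0 : Num.sqrt (- s) != 0 by rewrite sqrtr_eq0 oppr_le0 -ltNge.
  exists (Num.sqrt (- s)), (Num.sqrt (- s))^-1.
  by rewrite mulfV // subrr mul0r sub0r sqr_sqrtr ?opprK // oppr_ge0 ltW.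
Qed.

(** In both maps the first two summands of [g] give [x] on [y = 0] and [- x ^+ 2] on the other
    component of [h = 0]. The last summand vanishes on both components; elsewhere it provides the
    nonzero leading coefficient in odd degree, 3 in the closed case and 7 in the open one. *)
Lemma polynomial_imageU_half_space (T : set 'rV[R]_n) (closed : bool) :
  [set p | dotp u p + b != 0] `<=` T -> polynomial_image T ->
  polynomial_image (T `|` [set p | dotp v p + a < 0 ?<= if closed]).
Proof.
have [e [f [ue ve uf vf]]] := dotp_dual_pair u0 vu.
case: closed.
  (* The line [y = 1] is mapped onto [s <= 0] by [s = - x ^ 2]. *)
  apply: (@image_plane_map R n u v e f b a ue ve uf vf
    (fun x y => x - y * (x ^+ 2 + x) + y * (y - 1) * x ^+ 3)
    (fun _ y => y ^+ 2 * (y - 1)) _ _ [set s | s <= 0]) => //.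
  - by move=> X Y XP YP; polynomial_function_tac.
  - by move=> X Y XP YP; polynomial_function_tac.
  - by move=> x; split; ring.
  - move=> s c c0.
    have [||y /= yE] := @horner_rec_root R (- c) [:: 0; -1; 1] => //.
      by rewrite /= oner_neq0.
    have {}yE : y ^+ 2 * (y - 1) = c.
      by apply/eqP; rewrite -subr_eq0 -yE; apply/eqP; ring.
    have y0 : y != 0.
      by apply: contra c0 => /eqP y0; rewrite -yE y0 expr0n mul0r.
    have y1 : y - 1 != 0.
      by apply: contra c0 => /eqP y1; rewrite -yE y1 mulr0.
    have [||x /= xE] := @horner_rec_root R (- s) [:: 1 - y; - y; y * (y - 1)] => //.
      by rewrite /= mulf_neq0.
    by exists x, y; split=> //; apply/eqP; rewrite -subr_eq0 -xE; apply/eqP; ring.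
  - move=> x y y0 /eqP; rewrite mulf_eq0 expf_eq0 (negPf y0) /= subr_eq0 => /eqP ->.
    by rewrite subrr; have := sqr_ge0 x; lra.
  - move=> s /= s0; exists (Num.sqrt (- s)), 1; rewrite oner_neq0.
    by split=> //; rewrite ?subrr ?mulr0 // mul1r sqr_sqrtr ?oppr_ge0 //; ring.
(* The hyperbola [x * y = 1] is mapped onto [s < 0] by [s = - x ^ 2]. *)
apply: (@image_plane_map R n u v e f b a ue ve uf vf
    (fun x y => x - y * (x ^+ 3 + x ^+ 2) + y ^+ 3 * (x * y - 1))
    (fun x y => y * (x * y - 1)) _ _ [set s | s < 0]) => //.
- by move=> X Y XP YP; polynomial_function_tac.
- by move=> X Y XP YP; polynomial_function_tac.
- by move=> x; split; ring.
- move=> s c c0.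
  (* On [h x y = c], i.e. [x = (c + y) / y ^ 2], multiply [g x y = s] by [y ^ 5]. *)
  have [||y /= yE] := @horner_rec_root R (- c ^+ 3)
    [:: - (3%:R * c ^+ 2); - (3%:R * c + c ^+ 2); - 1 - c; 0; - s; 0; c] => //.
  have y0 : y != 0.
    apply: contra c0 => /eqP y0; rewrite y0 mulr0 add0r in yE.
    by move/eqP: yE; rewrite oppr_eq0 expf_eq0.
  exists ((c + y) / y ^+ 2), y; split=> //; last by field.
  apply/eqP; rewrite -subr_eq0; apply/eqP.
  transitivity (0 / y ^+ 5); last by rewrite mul0r.
  by rewrite -yE; field.
- move=> x y y0 /eqP; rewrite mulf_eq0 (negPf y0) /= subr_eq0 => /eqP xy.
  have x0 : x != 0 by apply/eqP => x0; move: xy => /eqP; rewrite x0 mul0r eq_sym oner_eq0.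
  have -> : x - y * (x ^+ 3 + x ^+ 2) + y ^+ 3 * (x * y - 1) =
    x - (x * y) * (x ^+ 2 + x) + y ^+ 3 * (x * y - 1) by ring.
  have : 0 < x ^+ 2 by rewrite exprn_even_gt0.
  by rewrite xy; lra.
- move=> s /= s0; have r0 : Num.sqrt (- s) != 0 by rewrite sqrtr_eq0 oppr_le0 -ltNge.
  exists (Num.sqrt (- s)), (Num.sqrt (- s))^-1; rewrite invr_eq0 r0.
  have sE : Num.sqrt (- s) ^+ 2 = - s by rewrite sqr_sqrtr // oppr_ge0 ltW.
  split=> //; last by rewrite mulfV // subrr mulr0.
  by rewrite -[RHS]opprK -[in RHS]sE; field.
Qed.

End AddHalfSpace.

(** * Adding finitely many half-spaces to the complement of a hyperplane *)

Section UnionsOfHalfSpaces.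
Variables (R : realType) (n : nat).
Implicit Types (u : 'rV[R]_n) (b : R) (S : set 'rV[R]_n).

(** The triple is [(closed, v, a)]; its flag lets one list mix open and closed half-spaces. *)
Definition in_half_space (p : 'rV[R]_n) (c : bool * 'rV[R]_n * R) : bool :=
  dotp c.1.2 p + c.2 < 0 ?<= if c.1.1.

(** The first alternative has to be kept apart: the complement of a hyperplane is disconnected, so
    it is no polynomial image. The first half-space not parallel to the hyperplane leaves this
    alternative through a map of the whole space, later ones through a map of [T]. *)
Lemma union_half_spaces u b (s : seq (bool * 'rV[R]_n * R)) : u != 0 ->
  let T := [set p | (dotp u p + b != 0) || has (in_half_space p) s] in
  T = [set p | dotp u p + b != 0] \/ polynomial_image T.
Proof.
move=> u0 /=; elim: s => [|[[closed v] a] s IH] /=.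
  by left; apply/seteqP; split=> p; rewrite /= orbF.
set T := [set p | _ || has _ s] in IH.
pose X := [set p : 'rV[R]_n | dotp v p + a < 0 ?<= if closed].
have -> : [set p | (dotp u p + b != 0) ||
    (in_half_space p (closed, v, a) || has (in_half_space p) s)] = T `|` X.
  apply/seteqP; split=> p; rewrite /T /X /in_half_space /= orbCA.
    by case/orP; [right|left].
  by case=> ->; rewrite ?orbT.
have YT : [set p | dotp u p + b != 0] `<=` T by move=> p p0; apply/orP; left.
have [vu|/forallNP vu] := pselect (exists c, v = c *: u); last first.
  have {}vu c : v != c *: u by apply/eqP/vu.
  right; case: IH => [->|TP]; first exact: polynomial_image_half_space.
  exact: (@polynomial_imageU_half_space _ _ u v b a).
have [c vE] := vu.
(* On the hyperplane the form [dotp v p + a] is constant, so [X] contains the hyperplane or misses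
   it. *)
have XE p : dotp u p + b = 0 -> X p = (a - c * b < 0 ?<= if closed) :> Prop.
  move=> /eqP; rewrite addr_eq0 => /eqP pE.
  by rewrite /X /= vE dotpZl pE mulrN addrC.
have [neg|nonneg] := boolP (a - c * b < 0 ?<= if closed).
  right; suff -> : T `|` X = setT by exact: polynomial_imageT.
  apply/seteqP; split=> // p _.
  have [p0|p0] := eqVneq (dotp u p + b) 0; last by left; exact: YT.
  by right; rewrite XE.
suff -> : T `|` X = T by [].
apply/seteqP; split=> p; last by left.
case=> // Xp; have [p0|p0] := eqVneq (dotp u p + b) 0; last exact: YT.
by move: Xp; rewrite XE // (negPf nonneg).
Qed.

(** Since [S] lies in the hyperplane, the list has to describe the complement only there. If no
    half-space contributed, [S] would be the whole hyperplane. *)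
Lemma polynomial_image_setC_half_spaces S u b (s : seq (bool * 'rV[R]_n * R)) :
  u != 0 -> S `<=` [set p | dotp u p + b = 0] ->
  (forall p, dotp u p + b = 0 -> ~ S p <-> has (in_half_space p) s) ->
  S <> [set p | dotp u p + b = 0] -> polynomial_image (~` S).
Proof.
move=> u0 Sub SP; have /= [] := union_half_spaces b s u0; last first.
  move=> TP _; suff -> : ~` S = [set p | (dotp u p + b != 0) || has (in_half_space p) s] by [].
  apply/seteqP; split=> p /=.
    by have [p0 /(SP _ p0)|] := eqVneq (dotp u p + b) 0.
  by have [p0 /= /(SP _ p0)//|+ _ /Sub] := eqVneq (dotp u p + b) 0; move/eqP.
move=> TE SY; case: SY; apply/seteqP; split=> // p p0.
apply: contrapT => nSp; have hp := (SP _ p0).1 nSp.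
have : [set p | dotp u p + b != 0] p by rewrite -TE /= hp orbT.
by rewrite /= p0 eqxx.
Qed.

End UnionsOfHalfSpaces.

(** * Linear equations of vector subspaces and flats *)

Section Flats.
Variables (R : realType) (n : nat) (V : {vspace 'rV[R]_n}).

(** The equations are the coordinates of [v - projv V v], which vanishes exactly on [V]. *)
Lemma vspace_equations : exists w : 'I_n -> 'rV[R]_n,
  forall v, v \in V <-> forall i, dotp (w i) v = 0.
Proof.
pose phi : 'End('rV[R]_n) := (\1 - projv V)%VF.
have phiE v : phi v = v - projv V v by rewrite !lfunE /= !lfunE.
exists (fun i => \row_j phi (delta_mx 0 j) 0 i) => v.
have wE i : dotp (\row_j phi (delta_mx 0 j) 0 i) v = phi v 0 i.
  rewrite [in RHS](row_sum_delta v) linear_sum summxE.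
  by apply: eq_bigr => j _; rewrite linearZ !mxE mulrC.
split=> [vV i|v0].
  by rewrite wE phiE projv_id // subrr mxE.
have : phi v = 0 by apply/rowP => i; rewrite -wE v0 mxE.
by rewrite phiE => /eqP; rewrite subr_eq0 => /eqP ->; exact: memv_proj.
Qed.

(** Some equation of [V] is nontrivial, since otherwise [V] would be the full space. *)
Lemma vspace_normal : (\dim V < n)%N ->
  exists2 u, u != 0 & forall v, v \in V -> dotp u v = 0.
Proof.
have [w wP] := vspace_equations => Vn.
have [/existsP[i wi]|/existsPn w0] := boolP [exists i, w i != 0].
  by exists (w i) => // v /wP.
suff VT : V = fullv by move: Vn; rewrite VT dimvf /dim /= mul1n ltnn.
apply/vspaceP => v; rewrite memvf; apply/wP => i.
by have := w0 i; rewrite negbK => /eqP ->; exact: dotp0l.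
Qed.

Variable p : 'rV[R]_n.

Lemma flatP x : flat p V x <-> x - p \in V.
Proof.
split=> [[v /= vV <-]|xV]; first by rewrite addrC addKr.
by exists (x - p) => //; rewrite subrKC.
Qed.

Lemma flat_line x y (t : R) :
  flat p V x -> flat p V y -> flat p V (x + t *: (y - x)).
Proof.
move=> /flatP xV /flatP yV; apply/flatP.
rewrite addrAC memvD // memvZ //.
have -> : y - x = y - p - (x - p) by rewrite opprB subrKA.
exact: memvB.
Qed.

(** An equation fails exactly when one of two opposite strict inequalities holds. *)
Lemma setC_flat_half_spaces : exists s : seq (bool * 'rV[R]_n * R),
  forall x, ~ flat p V x <-> has (in_half_space x) s.
Proof.
have [w wP] := vspace_equations.
have [I inI] : exists I : seq 'I_n, forall i, i \in I.
  by exists (enum 'I_n) => i; rewrite mem_enum.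
exists ([seq (false, w i, - dotp (w i) p) | i <- I] ++
        [seq (false, - w i, dotp (w i) p) | i <- I]) => x.
rewrite flatP has_cat !has_map; split=> [/wP/existsNP[i /eqP]|].
  rewrite dotpBr neq_lt => /orP[]wi; apply/orP; [left|right];
    apply/hasP; exists i; rewrite ?inI // /preim /in_half_space /= ?dotpNl //.
  by lra.
by case/orP => /hasP[i _] /= + /wP/(_ i); rewrite /in_half_space /= ?dotpNl dotpBr;
  lra.
Qed.

End Flats.

(** * The relative interior in terms of inequalities *)

Section RelativeInterior.
Variables (R : realType) (n : nat).

Lemma dotp_cvg (u x : 'rV[R]_n) : dotp u y @[y --> x] --> dotp u x.
Proof.
have nbhsF : Filter (nbhs x) := nbhs_filter x.
rewrite /dotp; elim: (index_enum _) => [|i s IH].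
  by rewrite big_nil; under eq_fun do rewrite big_nil; exact: cvg_cst.
rewrite big_cons; under eq_fun do rewrite big_cons.
apply: cvgD => //; apply: cvgM; first exact: cvg_cst.
exact: coord_continuous.
Qed.

Lemma subspace_interiorP (A S : set 'rV[R]_n) x : A x ->
  interior (S : set (subspace A)) x <-> \forall y \near x, A y -> S y.
Proof.
move=> Ax; change (nbhs_subspace (A := A) x S <-> within A (nbhs x) S).
by rewrite nbhs_subspace_in.
Qed.

(** A constraint that is an equality on the whole hull imposes nothing there. Any other one, if
    strict at [x], stays strict nearby by continuity. *)
Lemma relative_interiorP (m : nat) (w : 'I_m -> 'rV[R]_n) (c : 'I_m -> R)
    (p : 'rV[R]_n) (V : {vspace 'rV[R]_n}) (K := [set x | forall i, dotp (w i) x <= c i]) :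
  affine_hull K = flat p V ->
  forall x, relative_interior K x <-> flat p V x /\
    forall i, (exists2 y, flat p V y & dotp (w i) y != c i) -> dotp (w i) x < c i.
Proof.
move=> hullE x; have nbhsF : Filter (nbhs x) := nbhs_filter x.
rewrite /relative_interior hullE.
have KV : K `<=` flat p V by rewrite -hullE; exact: sub_gen_smallest.
split=> [|[Vx strict]]; last first.
  rewrite subspace_interiorP //.
  have : \forall y \near x, forall i, flat p V y -> dotp (w i) y <= c i.
    refine (@filter_forall _ _ (fun i y => flat p V y -> dotp (w i) y <= c i)
      _ nbhsF _) => i.
    have [/strict wx|noy] := pselect (exists2 y, flat p V y & dotp (w i) y != c i).
      have : \forall y \near x, dotp (w i) y < c i by exact: (cvgr_lt _ (@dotp_cvg (w i) x) _ wx).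
      by apply: filterS => y /ltW.
    apply: nearW => y Vy; have [->//|wy] := eqVneq (dotp (w i) y) (c i).
    by case: noy; exists y.
  by apply: filterS => y Ky Vy i; exact: Ky.
(* A linear form with a local maximum at [x] on the flat is constant there. *)
move=> intx; have Kx : K x := nbhs_singleton intx.
have Vx := KV _ Kx; split=> // i [y Vy wy].
rewrite lt_neqAle Kx andbT; apply/eqP => wx.
move: intx; rewrite subspace_interiorP // => intx.
have nbhsF0 : Filter (nbhs (0 : R)) := nbhs_filter 0.
have : x + t *: (y - x) @[t --> (0 : R)] --> x + 0 *: (y - x).
  by apply: cvgD; [exact: cvg_cst|exact: scalel_continuous].
rewrite scale0r addr0 => lineC.
have /nbhs_ballP[e /= e0 eK] := lineC _ intx.
have Kt t : `|t| < e -> t * (dotp (w i) y - c i) <= 0.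
  move=> te; have : K (x + t *: (y - x)).
    by apply: eK; [rewrite /ball /= sub0r normrN|exact: flat_line].
  by move=> /(_ i); rewrite dotpDr dotpZr dotpBr wx; lra.
(* Taking [t] equal to [e / 2] and to [- (e / 2)] forces the slope along the line to vanish,
   contrary to [wy]. *)
have e2 : `|e / 2| < e by rewrite ger0_norm; lra.
have := Kt _ e2; have := Kt (- (e / 2)); rewrite normrN => /(_ e2).
rewrite mulNr oppr_le0 => h1 h2; have /eqP : e / 2 * (dotp (w i) y - c i) = 0.
  by apply/eqP; rewrite eq_le h1 h2.
by rewrite mulf_eq0 subr_eq0 (negPf wy) orbF gt_eqF // divr_gt0.
Qed.

End RelativeInterior.

(** * The complements of a polyhedron and of its relative interior *)

Lemma convex_polyhedron_inequalities (R : realType) (n : nat) (K : set 'rV[R]_n) :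
  convex_polyhedron K -> exists m (w : 'I_m -> 'rV[R]_n) (c : 'I_m -> R),
    K = [set x | forall i, dotp (w i) x <= c i].
Proof.
move=> [m [H [/choice[w /choice[c Hwc]] ->]]]; exists m, w, c.
apply/seteqP; split=> x Kx i; first by have := Kx i I; rewrite (Hwc i).2.
by move=> _; rewrite (Hwc i).2; exact: Kx.
Qed.

Theorem mainTheorem2 (R : realType) (n : nat) (K : set 'rV[R]_n) (d : int)
    (polyK : convex_polyhedron K) (dimK : has_dimension K d)
    (d_lt_n : d < n%:Z) (K_not_hyperplane : ~ hyperplane K) :
  polynomial_image (~` K) /\ polynomial_image (~` relative_interior K).
Proof.
have Khull : K `<=` affine_hull K by exact: sub_gen_smallest.
have intK : relative_interior K `<=` K by move=> x intx; exact: nbhs_singleton intx.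
case: dimK => [[hull0 _]|[p [V [hullE dE]]]].
  have K0 : K = set0 by apply/seteqP; split=> // x /Khull; rewrite hull0.
  have -> : relative_interior K = set0 by apply/seteqP; split=> // x /intK; rewrite K0.
  by rewrite K0 setC0; split; exact: polynomial_imageT.
have [u u0 uV] : exists2 u, u != 0 & forall v, v \in V -> dotp u v = 0.
  by apply: vspace_normal; move: d_lt_n; rewrite dE ltz_nat.
(* The hyperplane [Y = 0] passes through [p] with normal [u], so it contains the hull. *)
have KY : K `<=` [set x | dotp u x + - dotp u p = 0].
  by move=> x /Khull; rewrite hullE => /flatP/uV; rewrite dotpBr.
have KneqY : K <> [set x | dotp u x + - dotp u p = 0].
  move=> KE; apply: K_not_hyperplane; exists u, (dotp u p); split=> //.
  by rewrite KE; apply/seteqP; split=> x /= => [/subr0_eq|->] //; rewrite subrr.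
have [m [w [c KE]]] := convex_polyhedron_inequalities polyK.
have [I inI] : exists I : seq 'I_m, forall i, i \in I.
  by exists (enum 'I_m) => i; rewrite mem_enum.
split.
  (* A point is outside [K] when some constraint is violated, which is an open condition. *)
  apply: (polynomial_image_setC_half_spaces
    (s := [seq (false, - w i, c i) | i <- I])) u0 KY _ KneqY.
  move=> x _; rewrite has_map KE; split=> [/existsNP[i /negP]|/hasP[i _] + /(_ i)].
    rewrite -ltNge => wx; apply/hasP; exists i; first exact: inI.
    by rewrite /preim /in_half_space /= dotpNl addrC subr_lt0.
  by rewrite /= /in_half_space /= dotpNl addrC subr_lt0 ltNge => /negP.
have [s sP] := setC_flat_half_spaces V p.
(* These constraints must be strict in the interior; the failure of strictness gives closed
   half-spaces, and leaving the hull gives the open ones in [s]. *)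
pose J i := `[< exists2 y, flat p V y & dotp (w i) y != c i >].
apply: (polynomial_image_setC_half_spaces (b := - dotp u p)
  (s := s ++ [seq (true, - w i, c i) | i <- I & J i])) u0 _ _ _.
- by move=> x /intK/KY.
- move=> x _; rewrite KE in hullE *; rewrite (relative_interiorP hullE).
  rewrite has_cat has_map; split=> [/not_andP[/sP ->//|/existsNP[i /not_implyP[Ji /negP]]]|].
    rewrite -leNgt => wx; apply/orP; right; apply/hasP; exists i.
      by rewrite mem_filter inI andbT; apply/asboolP.
    by rewrite /= /in_half_space /= dotpNl addrC subr_le0.
  case/orP => [/sP nV [] //|/hasP[i]]; rewrite mem_filter => /andP[/asboolP Ji _].
  by rewrite /= /in_half_space /= dotpNl addrC subr_le0 leNgt => /negP wx [_ /(_ i Ji)].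
(* If the relative interior were the hyperplane, so would be [K], which lies between the two. *)
- move=> intE; apply: KneqY; apply/seteqP; split=> // x.
  by rewrite -intE => /intK.
Qed.
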